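(* Let $L=2$ and consider the problem $\mathcal{P}^{\infty}_{\mathrm{dual}}$ (defined in the context). Put $c_k=1-\frac{\beta_k\gamma_k}{1+\gamma_k}$, $k=1,2$. Let $$\rho_{lo}=\begin{cases}0 & c_2-\beta_1\ge0\\ \frac{\epsilon_{1,2}\gamma_2}{\epsilon_{2,2}c_2}(\beta_1-c_2)&\text{otherwise}\end{cases},\qquad \rho_{hi}=\begin{cases}\infty & c_1-\beta_2\ge0\\ \frac{\epsilon_{1,1}c_1}{\gamma_1\epsilon_{2,1}(\beta_2-c_1)}&\text{otherwise}\end{cases}$$ and define $$h(\rho)=\epsilon_{1,1}\left[\frac{c_1}{\gamma_1}-\frac{\beta_2\epsilon_{2,1}\rho}{\epsilon_{1,1}+\rho\epsilon_{2,1}\gamma_1}\right]+\rho\epsilon_{2,2}\left[\frac{c_2}{\gamma_2}-\frac{\beta_1\epsilon_{1,2}}{\epsilon_{2,2}\rho+\epsilon_{1,2}\gamma_2}\right],$$ $$g_1(\rho)=\frac{\epsilon_{1,1}c_1}{\beta_1\gamma_1}-\frac{\frac{\beta_2}{\beta_1}\epsilon_{1,1}\epsilon_{2,1}^2\gamma_1}{\left(\epsilon_{1,1}\frac1\rho+\epsilon_{2,1}\gamma_1\right)^2}-\frac{\epsilon_{2,2}^2\epsilon_{1,2}}{\left(\epsilon_{2,2}+\frac1\rho\epsilon_{1,2}\gamma_2\right)^2},$$ $$g_2(\rho)=\frac{\epsilon_{2,2}c_2}{\beta_2\gamma_2}-\frac{\frac{\beta_1}{\beta_2}\epsilon_{2,2}\epsilon_{1,2}^2\gamma_2}{\left(\epsilon_{2,2}\rho+\epsilon_{1,2}\gamma_2\right)^2}-\frac{\epsilon_{1,1}^2\epsilon_{2,1}}{\left(\epsilon_{1,1}+\rho\epsilon_{2,1}\gamma_1\right)^2},$$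 with values at $\rho=0$ and $\rho=\infty$ understood as limits. Assume $\mathcal{P}^{\infty}_{\mathrm{dual}}$ is feasible. Let $\rho^*$ be equal to - $\rho_{lo}$, if $g_1(\rho_{lo})-g_2(\rho_{lo})\le0$ and $g_1(\rho_{hi})-g_2(\rho_{hi})<0$; - $\rho_{hi}$, if $g_1(\rho_{lo})-g_2(\rho_{lo})>0$ and $g_1(\rho_{hi})-g_2(\rho_{hi})\ge0$; - the value of $\rho$ at which $g_1$ and $g_2$ intersect, otherwise. Then the optimal pair $(\lambda_1^*,\lambda_2^* )$ of $\mathcal{P}^{\infty}_{\mathrm{dual}}$ is given by $\lambda_1^*=0$, $\lambda_2^*=\frac{2\gamma_2}{\epsilon_{2,2}c_2}$ if $\rho^*=\infty$, and by $\lambda_1^*=\frac{2}{h(\rho^* )}$, $\lambda_2^*=\frac{2\rho^*}{h(\rho^* )}$ otherwise. The optimal pair $(\mu_1^*,\mu_2^* )$ is given by $$\mu_1^*=\epsilon_{1,1}\lambda_1^*\left[\frac{c_1}{\gamma_1}-\frac{\beta_2\epsilon_{2,1}\lambda_2^*}{\epsilon_{1,1}\lambda_1^*+\epsilon_{2,1}\lambda_2^*\gamma_1}\right],$$ $$\mu_2^*=2-\mu_1^*=\epsilon_{2,2}\lambda_2^*\left[\frac{c_2}{\gamma_2}-\frac{\beta_1\epsilon_{1,2}\lambda_1^*}{\epsilon_{2,2}\lambda_2^*+\epsilon_{1,2}\lambda_1^*\gamma_2}\right].$$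
   Context: Let $\sigma^2>0$, $\beta_k>0$, $\gamma_k>0$, $\epsilon_{j,k}>0$ for $j,k\in\{1,2\}$, and $L=2$. $\mathcal{P}^{\infty}_{\mathrm{dual}}$ is: maximize $\sigma^2\sum_{k=1}^L\beta_k\lambda_k$ over $\boldsymbol\mu=(\mu_k)_{k=1}^L,\boldsymbol\lambda=(\lambda_k)_{k=1}^L$ subject to $\mu_k\ge0$, $\lambda_k\ge0$, $\sum_{k=1}^L(1-\mu_k)\ge0$, and $\lambda_k\le F_k(\boldsymbol\lambda,\mu_k,\gamma_k)$ for $k=1,\dots,L$, where $$F_k(\boldsymbol\lambda,\mu_k,\gamma_k)=\frac{\gamma_k}{\epsilon_{k,k}\,\bar m_k(-\mu_k,\boldsymbol\lambda)};$$ here $\bar m_k(-\mu_k,\boldsymbol\lambda)=m_k(-\mu_k,\boldsymbol\lambda)$ if $\mu_k>0$, or if $\mu_k=0$ and $\sum_j\beta_jI_{\lambda_j}>1$; and $\bar m_k=\infty$ (so that $F_k=0$) otherwise. $I_x$ equals $1$ if $x>0$ and $0$ otherwise, and $m_k=m_k(-\mu_k,\boldsymbol\lambda)$ is the unique positive solution of $$m_k=\frac{1}{\mu_k+\sum_{j=1}^L\frac{\beta_j\lambda_j\epsilon_{j,k}}{1+\lambda_j\epsilon_{j,k}m_k}}.$$ ''Feasible'' for $\mathcal{P}^{\infty}_{\mathrm{dual}}$ means that its optimal value is bounded (finite); standing assumption: $c_k>0$, $k=1,2$ (otherwise the problem is infeasible in this sense). *)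

(* Defs.v *)
From HB Require Import structures.
From mathcomp Require Import all_boot all_order all_algebra.
From mathcomp Require Import all_classical all_reals all_analysis.
Set Implicit Arguments.
Unset Strict Implicit.
Unset Printing Implicit Defensive.
Import Order.TTheory GRing.Theory Num.Theory.
Import numFieldNormedType.Exports.
Local Open Scope classical_set_scope.
Local Open Scope ring_scope.

(* [eps j k] stands for epsilon_{j,k}; the second index is that of the constraint. *)

(* m_k(- mu_k, lambda). *)
Definition m_sol (R : realType) (L : nat) (beta : 'I_L -> R)
    (eps : 'I_L -> 'I_L -> R) (muk : R) (lam : 'I_L -> R) (k : 'I_L) : R :=
  xget 0 [set m : R | 0 < m /\
    m = 1 / (muk + \sum_(j < L) (beta j * lam j * eps j k) /
                                (1 + lam j * eps j k * m))].

Definition m_bar (R : realType) (L : nat) (beta : 'I_L -> R)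
    (eps : 'I_L -> 'I_L -> R) (muk : R) (lam : 'I_L -> R) (k : 'I_L) : \bar R :=
  if (0 < muk) ||
     ((muk == 0) && (1 < \sum_(j < L) beta j * (0 < lam j)%R%:R))
  then (m_sol beta eps muk lam k)%:E else +oo%E.

(* The division is the one of \bar R, in which x / +oo = 0 for real x. *)
Definition F (R : realType) (L : nat) (beta gamma : 'I_L -> R)
    (eps : 'I_L -> 'I_L -> R) (lam : 'I_L -> R) (muk : R) (k : 'I_L) : \bar R :=
  ((gamma k)%:E / ((eps k k)%:E * m_bar beta eps muk lam k))%E.

Definition dual_constraints (R : realType) (L : nat) (beta gamma : 'I_L -> R)
    (eps : 'I_L -> 'I_L -> R) (mu lam : 'I_L -> R) : Prop :=
  [/\ forall k, 0 <= mu k,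
      forall k, 0 <= lam k,
      0 <= \sum_(k < L) (1 - mu k)
    & forall k, ((lam k)%:E <= F beta gamma eps lam (mu k) k)%E].

Definition dual_objective (R : realType) (L : nat) (sigma2 : R)
    (beta lam : 'I_L -> R) : R :=
  sigma2 * \sum_(k < L) beta k * lam k.

Definition dual_value (R : realType) (L : nat) (sigma2 : R)
    (beta gamma : 'I_L -> R) (eps : 'I_L -> 'I_L -> R) : \bar R :=
  ereal_sup [set v : \bar R | exists mu lam : 'I_L -> R,
    dual_constraints beta gamma eps mu lam /\
    v = (dual_objective sigma2 beta lam)%:E].

(* "Feasible" refers to the boundedness of the dual optimum, i.e. to the
   feasibility of the primal problem; the constraint set of the dual itself is
   never empty. *)
Definition dual_feasible (R : realType) (L : nat) (sigma2 : R)
    (beta gamma : 'I_L -> R) (eps : 'I_L -> 'I_L -> R) : Prop :=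
  dual_value sigma2 beta gamma eps \is a fin_num.

Definition dual_optimal (R : realType) (L : nat) (sigma2 : R)
    (beta gamma : 'I_L -> R) (eps : 'I_L -> 'I_L -> R)
    (mu lam : 'I_L -> R) : Prop :=
  dual_constraints beta gamma eps mu lam /\
  forall mu' lam' : 'I_L -> R, dual_constraints beta gamma eps mu' lam' ->
    dual_objective sigma2 beta lam' <= dual_objective sigma2 beta lam.

Definition c (R : realType) (L : nat) (beta gamma : 'I_L -> R) (k : 'I_L) : R :=
  1 - beta k * gamma k / (1 + gamma k).

(* The indices 1 and 2. *)
Notation k1 := (@Ordinal 2 0 isT).
Notation k2 := (@Ordinal 2 1 isT).

Definition rho_lo (R : realType) (beta gamma : 'I_2 -> R)
    (eps : 'I_2 -> 'I_2 -> R) : \bar R :=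
  let c2 := c beta gamma k2 in
  if 0 <= c2 - beta k1 then 0%E
  else (eps k1 k2 * gamma k2 / (eps k2 k2 * c2) * (beta k1 - c2))%:E.

Definition rho_hi (R : realType) (beta gamma : 'I_2 -> R)
    (eps : 'I_2 -> 'I_2 -> R) : \bar R :=
  let c1 := c beta gamma k1 in
  if 0 <= c1 - beta k2 then +oo%E
  else (eps k1 k1 * c1 / (gamma k1 * eps k2 k1 * (beta k2 - c1)))%:E.

Definition h (R : realType) (beta gamma : 'I_2 -> R)
    (eps : 'I_2 -> 'I_2 -> R) (rho : R) : R :=
  let c1 := c beta gamma k1 in
  let c2 := c beta gamma k2 in
  eps k1 k1 * (c1 / gamma k1 - beta k2 * eps k2 k1 * rho /
                               (eps k1 k1 + rho * eps k2 k1 * gamma k1)) +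
  rho * eps k2 k2 * (c2 / gamma k2 - beta k1 * eps k1 k2 /
                                     (eps k2 k2 * rho + eps k1 k2 * gamma k2)).

Definition g1 (R : realType) (beta gamma : 'I_2 -> R)
    (eps : 'I_2 -> 'I_2 -> R) (rho : R) : R :=
  eps k1 k1 * c beta gamma k1 / (beta k1 * gamma k1)
  - (beta k2 / beta k1 * eps k1 k1 * eps k2 k1 ^+ 2 * gamma k1) /
    (eps k1 k1 * (1 / rho) + eps k2 k1 * gamma k1) ^+ 2
  - (eps k2 k2 ^+ 2 * eps k1 k2) /
    (eps k2 k2 + 1 / rho * eps k1 k2 * gamma k2) ^+ 2.

Definition g2 (R : realType) (beta gamma : 'I_2 -> R)
    (eps : 'I_2 -> 'I_2 -> R) (rho : R) : R :=
  eps k2 k2 * c beta gamma k2 / (beta k2 * gamma k2)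
  - (beta k1 / beta k2 * eps k2 k2 * eps k1 k2 ^+ 2 * gamma k2) /
    (eps k2 k2 * rho + eps k1 k2 * gamma k2) ^+ 2
  - (eps k1 k1 ^+ 2 * eps k2 k1) /
    (eps k1 k1 + rho * eps k2 k1 * gamma k1) ^+ 2.

(* Value at rho in [0, +oo], the values at the end points being limits; the
   value at -oo is irrelevant. *)
Definition at_ext (R : realType) (f : R -> R) (rho : \bar R) : R :=
  match rho with
  | r%:E => if r == 0 then lim (f x @[x --> 0^'+]) else f r
  | +oo%E => lim (f x @[x --> +oo])
  | -oo%E => 0
  end.

(* "rho is the value designated as rho^*"; in the remaining case it is a
   point of [0, +oo] at which g1 and g2 intersect. *)
Definition is_rho_star (R : realType) (beta gamma : 'I_2 -> R)
    (eps : 'I_2 -> 'I_2 -> R) (rho : \bar R) : Prop :=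
  let G1 := at_ext (g1 beta gamma eps) in
  let G2 := at_ext (g2 beta gamma eps) in
  let lo := rho_lo beta gamma eps in
  let hi := rho_hi beta gamma eps in
  if (G1 lo - G2 lo <= 0) && (G1 hi - G2 hi < 0) then rho = lo
  else if (0 < G1 lo - G2 lo) && (0 <= G1 hi - G2 hi) then rho = hi
  else (0 <= rho)%E /\ G1 rho = G2 rho.

Definition lam_star (R : realType) (beta gamma : 'I_2 -> R)
    (eps : 'I_2 -> 'I_2 -> R) (rho : \bar R) (k : 'I_2) : R :=
  if rho == +oo%E then
    (if k == k1 then 0
     else 2 * gamma k2 / (eps k2 k2 * c beta gamma k2))
  else
    (if k == k1 then 2 / at_ext (h beta gamma eps) rho
     else 2 * fine rho / at_ext (h beta gamma eps) rho).

Definition mu_star (R : realType) (beta gamma : 'I_2 -> R)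
    (eps : 'I_2 -> 'I_2 -> R) (lam : 'I_2 -> R) (k : 'I_2) : R :=
  if k == k1 then
    eps k1 k1 * lam k1 *
      (c beta gamma k1 / gamma k1 - beta k2 * eps k2 k1 * lam k2 /
         (eps k1 k1 * lam k1 + eps k2 k1 * lam k2 * gamma k1))
  else
    eps k2 k2 * lam k2 *
      (c beta gamma k2 / gamma k2 - beta k1 * eps k1 k2 * lam k1 /
         (eps k2 k2 * lam k2 + eps k1 k2 * lam k1 * gamma k2)).

(* Main.v *)
(* Multiplying the equation of m_k by m_k turns it into load m = 1 with load
   increasing, so that lambda_k <= F_k amounts to mu_k >= N_k(lambda), where N_k
   is the expression given in the theorem for mu_k^*. Hence the problem is to
   maximise b . lambda subject to max(0, N_1) + max(0, N_2) <= 2. Each N_k is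
   linear minus a multiple of the concave function x y / (A x + B y), thus convex
   and homogeneous of degree 1, and g_k = d(N_1 + N_2)/d lambda_k / beta_k
   depends on rho = lambda_2 / lambda_1 only; g_1 - g_2 is strictly decreasing.
   N_1 > 0 exactly for rho < rho_hi and N_2 > 0 exactly for rho > rho_lo, and
   boundedness forces rho_lo < rho_hi. At rho^* there are s, t in [0, 1] for which
   the gradient of s N_1 + t N_2 is a multiple of b; the tangent inequality for
   this convex function, strict off the ray, gives optimality and uniqueness. *)

Require Import Defs.
From HB Require Import structures.
From mathcomp Require Import all_boot all_order all_algebra.
From mathcomp Require Import all_classical all_reals all_analysis.
From mathcomp Require Import ring lra.
Import Order.TTheory GRing.Theory Num.Theory.
Import numFieldNormedType.Exports.
Local Open Scope classical_set_scope.
Local Open Scope ring_scope.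

(** * The concave function x y / (A x + B y) and its tangent planes *)

Definition harm {R : realFieldType} (A B x y : R) : R := x * y / (A * x + B * y).

(** [harm_dx] and [harm_dy] are the partial derivatives of [harm], given in closed form so that
    concavity can be proved by algebra alone. *)
Definition harm_dx {R : realFieldType} (A B x y : R) : R :=
  B * y ^+ 2 / (A * x + B * y) ^+ 2.

Definition harm_dy {R : realFieldType} (A B x y : R) : R :=
  A * x ^+ 2 / (A * x + B * y) ^+ 2.

Section Harm.
Context {R : realFieldType} {A B : R} (A0 : 0 < A) (B0 : 0 < B).

Lemma harm_den_gt0 (x y : R) : 0 <= x -> 0 <= y -> 0 < x + y ->
  0 < A * x + B * y.
Proof.
move=> x0 y0 xy.
have [xp|xn] := ltP 0 x.
  by apply: ltr_pwDl; rewrite ?mulr_gt0// mulr_ge0// ltW.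
by apply: ltr_wpDl; [rewrite mulr_ge0// ltW | rewrite mulr_gt0//; lra].
Qed.

Lemma harm_scale (t x y : R) : t != 0 ->
  harm A B (t * x) (t * y) = t * harm A B x y.
Proof.
move=> t0; rewrite /harm.
have -> : A * (t * x) + B * (t * y) = t * (A * x + B * y) by ring.
by rewrite invfM; move: (_ + _)^-1 => i; field.
Qed.

Lemma harm_dx_scale (t x y : R) : t != 0 ->
  harm_dx A B (t * x) (t * y) = harm_dx A B x y.
Proof.
move=> t0; rewrite /harm_dx.
have -> : A * (t * x) + B * (t * y) = t * (A * x + B * y) by ring.
by rewrite !exprMn invfM; move: ((_ + _) ^+ 2)^-1 => i; field.
Qed.

Lemma harm_dy_scale (t x y : R) : t != 0 ->
  harm_dy A B (t * x) (t * y) = harm_dy A B x y.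
Proof.
move=> t0; rewrite /harm_dy.
have -> : A * (t * x) + B * (t * y) = t * (A * x + B * y) by ring.
by rewrite !exprMn invfM; move: ((_ + _) ^+ 2)^-1 => i; field.
Qed.

Lemma harm_euler (x y : R) : 0 <= x -> 0 <= y -> 0 < x + y ->
  harm_dx A B x y * x + harm_dy A B x y * y = harm A B x y.
Proof.
move=> x0 y0 xy; have D := lt0r_neq0 (harm_den_gt0 _ _ x0 y0 xy).
by rewrite /harm_dx /harm_dy /harm; field.
Qed.

(** An exact form of concavity: the distance to the tangent plane is a square, divided by a positive
    denominator off the origin, and it vanishes exactly along the ray of (x0, y0). *)
Lemma harm_tangent_gap (x0 y0 x y : R) : A * x0 + B * y0 != 0 ->
    0 <= x -> 0 <= y ->
  harm_dx A B x0 y0 * x + harm_dy A B x0 y0 * y - harm A B x y =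
  A * B * (y0 * x - x0 * y) ^+ 2 /
    ((A * x0 + B * y0) ^+ 2 * (A * x + B * y)).
Proof.
move=> D0 x_ge0 y_ge0; rewrite /harm_dx /harm_dy /harm.
(* The remaining case is x = y = 0, where the denominator vanishes and [field] does not apply. *)
have [xy|xy] := ltP 0 (x + y); last first.
  have -> : x = 0 by lra.
  have -> : y = 0 by lra.
  by rewrite !(expr2, mulr0, mul0r, addr0, subr0).
have D := lt0r_neq0 (harm_den_gt0 _ _ x_ge0 y_ge0 xy).
by field; rewrite D D0.
Qed.

(** The equality case is recorded because uniqueness of the optimum rests on it. *)
Lemma harm_tangent (x0 y0 x y : R) :
    0 <= x0 -> 0 <= y0 -> 0 < x0 + y0 -> 0 <= x -> 0 <= y ->
  harm A B x y <= harm_dx A B x0 y0 * x + harm_dy A B x0 y0 * y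
               ?= iff (y0 * x == x0 * y).
Proof.
move=> x0_ge0 y0_ge0 xy0 x_ge0 y_ge0.
have D0 := harm_den_gt0 _ _ x0_ge0 y0_ge0 xy0.
have gap := harm_tangent_gap _ _ _ _ (lt0r_neq0 D0) x_ge0 y_ge0.
apply/leifP; rewrite -subr_eq0; case: eqVneq => [e|ne].
  by rewrite eq_sym -subr_eq0 gap e expr0n /= mulr0 mul0r.
rewrite -subr_gt0 gap.
have xy : 0 < x + y.
  rewrite lt_neqAle addr_ge0// andbT eq_sym; apply: contraNneq ne => xy.
  have -> : x = 0 by lra.
  have -> : y = 0 by lra.
  by rewrite !mulr0 subrr.
have D := harm_den_gt0 _ _ x_ge0 y_ge0 xy.
have sq : 0 < (y0 * x - x0 * y) ^+ 2.
  by rewrite lt_neqAle eq_sym sqrf_eq0 ne sqr_ge0.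
by apply: divr_gt0; apply: mulr_gt0; rewrite // ?mulr_gt0 ?exprn_gt0.
Qed.

(** Cross-multiplied, x' * y < x * y' says that the ray of (x', y') is the steeper one, vertical
    rays included. [harm_dx] is B times the square of y / (A x + B y), which grows with the
    slope. *)
Lemma harm_dx_lt (x y x' y' : R) : 0 <= x -> 0 <= y -> 0 < x + y ->
    0 <= x' -> 0 <= y' -> 0 < x' + y' -> x' * y < x * y' ->
  harm_dx A B x y < harm_dx A B x' y'.
Proof.
move=> x0 y0 xy x'0 y'0 xy' lt.
have D := harm_den_gt0 _ _ x0 y0 xy; have D' := harm_den_gt0 _ _ x'0 y'0 xy'.
rewrite /harm_dx -[ltLHS]mulrA -[ltRHS]mulrA ltr_pM2l//.
rewrite -!expr_div_n ltr_pXn2r//.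
- rewrite ltr_pdivrMr// mulrAC ltr_pdivlMr//.
  rewrite -subr_gt0.
  have -> : y' * (A * x + B * y) - y * (A * x' + B * y') =
            A * (x * y' - x' * y) by ring.
  by rewrite mulr_gt0// subr_gt0.
- by rewrite nnegrE divr_ge0// ltW.
- by rewrite nnegrE divr_ge0// ltW.
Qed.

Lemma harm_dy_lt (x y x' y' : R) : 0 <= x -> 0 <= y -> 0 < x + y ->
    0 <= x' -> 0 <= y' -> 0 < x' + y' -> x' * y < x * y' ->
  harm_dy A B x' y' < harm_dy A B x y.
Proof.
move=> x0 y0 xy x'0 y'0 xy' lt.
have D := harm_den_gt0 _ _ x0 y0 xy; have D' := harm_den_gt0 _ _ x'0 y'0 xy'.
rewrite /harm_dy -[ltLHS]mulrA -[ltRHS]mulrA ltr_pM2l//.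
rewrite -!expr_div_n ltr_pXn2r//.
- rewrite ltr_pdivrMr// mulrAC ltr_pdivlMr//.
  rewrite -subr_gt0.
  have -> : x * (A * x' + B * y') - x' * (A * x + B * y) =
            B * (x * y' - x' * y) by ring.
  by rewrite mulr_gt0// subr_gt0.
- by rewrite nnegrE divr_ge0// ltW.
- by rewrite nnegrE divr_ge0// ltW.
Qed.

End Harm.

(** * The saturating function a m / (1 + a m) *)

Section Saturation.
Context {R : realFieldType}.

Lemma saturation_lt (a m n : R) : 0 < a -> 0 <= m -> m < n ->
  a * m / (1 + a * m) < a * n / (1 + a * n).
Proof.
move=> a0 m0 mn.
have am : 0 <= a * m by rewrite mulr_ge0// ltW.
have amn : a * m < a * n by rewrite ltr_pM2l.
rewrite ltr_pdivrMr; last by lra.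
by rewrite mulrAC ltr_pdivlMr; nra.
Qed.

Lemma saturation_le (a m n : R) : 0 <= a -> 0 <= m -> m <= n ->
  a * m / (1 + a * m) <= a * n / (1 + a * n).
Proof.
rewrite le_eqVlt => /predU1P[<-|a0] m0; first by rewrite !mul0r.
by rewrite le_eqVlt => /predU1P[->//|mn]; rewrite ltW// saturation_lt.
Qed.

Lemma saturation_lt1 (a m : R) : 0 <= a -> 0 <= m -> a * m / (1 + a * m) < 1.
Proof.
move=> a0 m0; have am : 0 <= a * m by rewrite mulr_ge0.
by rewrite ltr_pdivrMr; lra.
Qed.

(* For a = 0 both sides vanish, because 0^-1 = 0. *)
Lemma saturation_ge (a m : R) : 0 <= a -> 0 < m ->
  (0 < a)%R%:R - a^-1 / m <= a * m / (1 + a * m).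
Proof.
rewrite le_eqVlt => /predU1P[<-|a0] m0.
  by rewrite ltxx invr0 !mul0r subrr.
have am : 0 < a * m by rewrite mulr_gt0.
rewrite a0 -invfM -subr_ge0.
have -> : a * m / (1 + a * m) - (1%:R - (a * m)^-1) =
    1 / ((a * m) * (1 + a * m)).
  field; rewrite ?andbT; apply/and3P; split; lra.
by rewrite divr_ge0// mulr_ge0; lra.
Qed.

End Saturation.

(* m times the denominator of the fixed-point equation defining m_k, where
   a j stands for lambda_j epsilon_{j,k}; that equation reads load m = 1. *)
Definition load {R : realFieldType} {L : nat} (b a : 'I_L -> R) (mu m : R) : R :=
  mu * m + \sum_(j < L) b j * (a j * m / (1 + a j * m)).

(** * Solvability of the equation load m = 1 *)

Section Load.
Context {R : realType} {L : nat} {b a : 'I_L -> R} {mu : R}.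
Hypotheses (b0 : forall j, 0 < b j) (a0 : forall j, 0 <= a j) (mu0 : 0 <= mu).

Lemma load_lt (k : 'I_L) (m n : R) : 0 < a k -> 0 <= m -> m < n ->
  load b a mu m < load b a mu n.
Proof.
move=> ak m0 mn; apply: ler_ltD; first by rewrite ler_wpM2l// ltW.
rewrite (bigD1 k)//= [ltRHS](bigD1 k)//=; apply: ltr_leD.
  by rewrite ltr_pM2l// saturation_lt.
by apply: ler_sum => j _; rewrite ler_pM2l// saturation_le// ltW.
Qed.

(** For mu = 0 the load stays below its limit, the weight of the support. If that weight is at most
    1, the load never reaches 1; this is the case in which [m_bar] is infinite. *)
Lemma load_lt_support (k : 'I_L) (m : R) : 0 < a k -> 0 <= m ->
  load b a 0 m < \sum_(j < L) b j * (0 < a j)%R%:R.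
Proof.
move=> ak m0; rewrite /load mul0r add0r.
rewrite (bigD1 k)//= [ltRHS](bigD1 k)//=; apply: ltr_leD.
  by rewrite ak ltr_pM2l// saturation_lt1// ltW.
apply: ler_sum => j _; rewrite ler_pM2l//.
have := a0 j; rewrite le_eqVlt => /predU1P[<-|aj].
  by rewrite !mul0r ltxx.
by rewrite aj ltW// saturation_lt1// ltW.
Qed.

(** For mu > 0 the linear term alone reaches 1 at 1 / mu. For mu = 0 each summand falls short of its
    limit by at most (b j / a j) / m, so m is taken large enough for the total shortfall B / m to
    stay below the excess S0 - 1. *)
Lemma load_ge1 :
    (0 < mu) || ((mu == 0) && (1 < \sum_(j < L) b j * (0 < a j)%R%:R)) ->
  exists2 m, 0 < m & 1 <= load b a mu m.
Proof.
have sum_ge0 m : 0 <= m -> 0 <= \sum_(j < L) b j * (a j * m / (1 + a j * m)).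
  move=> m0; apply: sumr_ge0 => j _; apply: mulr_ge0; first exact: ltW.
  by rewrite divr_ge0 ?addr_ge0 ?mulr_ge0.
case/orP => [mup|/andP[/eqP -> S]].
  exists mu^-1; first by rewrite invr_gt0.
  by rewrite /load mulfV ?lt0r_neq0// lerDl sum_ge0// invr_ge0.
set S0 := \sum_(j < L) _ in S; pose B := \sum_(j < L) b j / a j.
have B0 : 0 <= B by apply: sumr_ge0 => j _; rewrite divr_ge0// ltW.
(* the addend 1 keeps m positive *)
pose m := (B + 1) / (S0 - 1).
have mp : 0 < m by rewrite divr_gt0; lra.
exists m => //; rewrite /load mul0r add0r.
have : S0 - B / m <= \sum_(j < L) b j * (a j * m / (1 + a j * m)).
  rewrite mulr_suml -sumrB; apply: ler_sum => j _.
  by rewrite -mulrA -mulrBr ler_pM2l// saturation_ge.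
apply: le_trans; rewrite lerBrDr -lerBrDl ler_pdivrMr// /m mulrCA mulfV; lra.
Qed.

Lemma continuous_load (m : R) : 0 <= m -> {for m, continuous (load b a mu)}.
Proof.
move=> m0; apply: cvgD; first exact: (cvgM (cvg_cst _) cvg_id).
apply: cvg_big => [|j _]; first exact: add_continuous.
apply: (cvgM (cvg_cst _)); apply: cvgM.
  exact: (cvgM (cvg_cst _) cvg_id).
apply: cvgV; first by rewrite lt0r_neq0// ltr_pwDl// mulr_ge0.
by apply: (cvgD (cvg_cst _)); exact: (cvgM (cvg_cst _) cvg_id).
Qed.

Lemma load_eq1 :
    (0 < mu) || ((mu == 0) && (1 < \sum_(j < L) b j * (0 < a j)%R%:R)) ->
  exists2 m, 0 < m & load b a mu m = 1.
Proof.
move=> /load_ge1[n n0 ln].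
have l0 : load b a mu 0 = 0.
  by rewrite /load mulr0 add0r big1// => j _; rewrite mulr0 mul0r mulr0.
have [||m] := @IVT R (load b a mu) 0 n 1 (ltW n0).
- apply: continuous_in_subspaceT => x; rewrite inE/= in_itv/= => /andP[x0 _].
  exact: continuous_load.
- by rewrite l0 minEle maxEle (le_trans ler01 ln) ler01.
rewrite in_itv/= le_eqVlt => /andP[/predU1P[<-|m0] _ lm]; last by exists m.
by move: lm; rewrite l0 => /eqP; rewrite eq_sym oner_eq0.
Qed.

End Load.

(** * The constraint lambda_k <= F_k in terms of the load *)

Section ConstraintF.
Context {R : realType} {L : nat} {beta gamma : 'I_L -> R}.
Context {eps : 'I_L -> 'I_L -> R} {lam : 'I_L -> R} {muk : R}.
Hypotheses (beta0 : forall j, 0 < beta j) (gamma0 : forall j, 0 < gamma j).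
Hypotheses (eps0 : forall i j, 0 < eps i j).
Hypotheses (lam0 : forall j, 0 <= lam j) (muk0 : 0 <= muk).

Let a (k j : 'I_L) := lam j * eps j k.
Let a0 k j : 0 <= a k j. Proof. by rewrite mulr_ge0// ltW. Qed.
Let supp k : \sum_(j < L) beta j * (0 < a k j)%R%:R =
  \sum_(j < L) beta j * (0 < lam j)%R%:R.
Proof. by apply: eq_bigr => j _; rewrite /a pmulr_lgt0. Qed.

Lemma m_solP (k : 'I_L) :
    (0 < muk) || ((muk == 0) && (1 < \sum_(j < L) beta j * (0 < lam j)%R%:R)) ->
  0 < m_sol beta eps muk lam k /\
  load beta (fun j => lam j * eps j k) muk (m_sol beta eps muk lam k) = 1.
Proof.
rewrite -(supp k) => /(load_eq1 beta0 (a0 k) muk0)[m m0 lm].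
have loadE (x : R) : load beta (a k) muk x = x *
    (muk + \sum_(j < L) (beta j * lam j * eps j k) / (1 + lam j * eps j k * x)).
  rewrite /load mulrDr mulr_sumr mulrC; congr +%R; apply: eq_bigr => j _.
  by rewrite /a !mulrA; congr (_ / _); ring.
(* The second case of [xgetP], that no solution exists, is refuted by the [m] found above. *)
rewrite /m_sol; case: xgetP => [x -> /= [x0 xE]|/(_ m) []].
  split=> //; rewrite -/(a k) loadE {1}xE div1r mulVf//.
  (* A zero denominator would give x = 0, because 0^-1 = 0. *)
  by apply/eqP => z; move: x0; rewrite xE z invr0 mulr0 ltxx.
split=> //; have := lm; rewrite loadE => mX.
rewrite div1r; apply: invr_inj; rewrite invrK.
by apply: (mulfI (lt0r_neq0 m0)); rewrite mX mulfV// lt0r_neq0.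
Qed.

(** With n = gamma k / (eps k k * lam k) the constraint reads m_k <= n, which by monotonicity of the
    load is 1 = load m_k <= load n. Where [m_bar] is infinite, F is 0 and the load stays below 1, so
    both sides amount to lam k = 0. *)
Lemma le_F (k : 'I_L) :
  ((lam k)%:E <= F beta gamma eps lam muk k)%E <->
  lam k = 0 \/ 1 <= load beta (fun j => lam j * eps j k) muk
                      (gamma k / (eps k k * lam k)).
Proof.
rewrite /F /m_bar; case: ifPn => guard.
  have [m0 lm] := m_solP k guard; set m := m_sol _ _ _ _ _ in m0 lm *.
  have em : 0 < eps k k * m by rewrite mulr_gt0.
  rewrite -EFinM inver gt_eqF// -EFinM lee_fin ler_pdivlMr//.
  have := lam0 k; rewrite le_eqVlt => /predU1P[z|lk].
    by rewrite -z mul0r; split => _; [left | exact: ltW].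
  set n := gamma k / _.
  have n0 : 0 < n by rewrite divr_gt0 ?mulr_gt0.
  have ak : 0 < a k k by rewrite mulr_gt0.
  have -> : (lam k * (eps k k * m) <= gamma k) = (m <= n).
    by rewrite ler_pdivlMr ?mulr_gt0//; congr (_ <= _); ring.
  rewrite -lm; split=> [|[z|]].
  - rewrite le_eqVlt => /predU1P[->|mn]; right=> //.
    by apply/ltW/(load_lt beta0 (a0 k) muk0 k) => //; exact: ltW.
  - by move: lk; rewrite z ltxx.
  - rewrite leNgt; apply: contraNle => nm.
    by apply: (load_lt beta0 (a0 k) muk0 k) => //; exact: ltW.
rewrite gt0_muley ?lte_fin// invey mule0 lee_fin; split=> [z|[->//|l1]].
  by left; apply/eqP; rewrite eq_le z lam0.
have := lam0 k; rewrite le_eqVlt => /predU1P[<-//|lk].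
move: guard; rewrite negb_or -leNgt => /andP[m0].
have -> : muk = 0 by apply/eqP; rewrite eq_le m0 muk0.
rewrite eqxx/= -leNgt -(supp k) => s1; exfalso.
move: l1; have -> : muk = 0 by apply/eqP; rewrite eq_le m0 muk0.
apply/negP; rewrite -ltNge; apply: lt_le_trans s1.
apply: (load_lt_support beta0 (a0 k) k); first by rewrite mulr_gt0.
by rewrite divr_ge0 ?mulr_ge0// ltW.
Qed.

End ConstraintF.

(* With the parameters of Section Dual, needk x y is the least mu_k compatible
   with constraint k at lambda = (x, y). *)
Definition need1 {R : realFieldType} (al1 ka1 A1 B1 x y : R) : R :=
  al1 * x - ka1 * harm A1 B1 x y.
Definition need1_dx {R : realFieldType} (al1 ka1 A1 B1 x y : R) : R :=
  al1 - ka1 * harm_dx A1 B1 x y.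
Definition need1_dy {R : realFieldType} (ka1 A1 B1 x y : R) : R :=
  - (ka1 * harm_dy A1 B1 x y).
Definition need2 {R : realFieldType} (al2 ka2 A2 B2 x y : R) : R :=
  al2 * y - ka2 * harm A2 B2 x y.
Definition need2_dx {R : realFieldType} (ka2 A2 B2 x y : R) : R :=
  - (ka2 * harm_dx A2 B2 x y).
Definition need2_dy {R : realFieldType} (al2 ka2 A2 B2 x y : R) : R :=
  al2 - ka2 * harm_dy A2 B2 x y.

(** * First-order optimality for two users *)

Section TwoUsers.
Context {R : realFieldType} {al1 ka1 A1 B1 al2 ka2 A2 B2 b1 b2 : R}.

Local Notation N1 := (need1 al1 ka1 A1 B1).
Local Notation N1x := (need1_dx al1 ka1 A1 B1).
Local Notation N1y := (need1_dy ka1 A1 B1).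
Local Notation N2 := (need2 al2 ka2 A2 B2).
Local Notation N2x := (need2_dx ka2 A2 B2).
Local Notation N2y := (need2_dy al2 ka2 A2 B2).

(** This is g_1 - g_2 in homogeneous coordinates, rho being y / x; the point (0, 1) represents rho =
    +oo. *)
Definition slope_gap (x y : R) : R :=
  (N1x x y + N2x x y) / b1 - (N1y x y + N2y x y) / b2.

Hypotheses (ka1_gt0 : 0 < ka1) (A1_gt0 : 0 < A1) (B1_gt0 : 0 < B1)
  (ka2_gt0 : 0 < ka2) (A2_gt0 : 0 < A2) (B2_gt0 : 0 < B2)
  (b1_gt0 : 0 < b1) (b2_gt0 : 0 < b2).

Lemma need1_scale (t x y : R) : t != 0 -> N1 (t * x) (t * y) = t * N1 x y.
Proof. by move=> t0; rewrite /need1 harm_scale//; ring. Qed.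

Lemma need2_scale (t x y : R) : t != 0 -> N2 (t * x) (t * y) = t * N2 x y.
Proof. by move=> t0; rewrite /need2 harm_scale//; ring. Qed.

Lemma slope_gap_scale (t x y : R) : t != 0 ->
  slope_gap (t * x) (t * y) = slope_gap x y.
Proof.
move=> t0; rewrite /slope_gap /need1_dx /need1_dy /need2_dx /need2_dy.
by rewrite !harm_dx_scale// !harm_dy_scale.
Qed.

(** On a steeper ray both [harm_dx] terms are larger and both [harm_dy] terms smaller, and each
    enters with a negative coefficient. *)
Lemma slope_gap_lt (x y x' y' : R) : 0 <= x -> 0 <= y -> 0 < x + y ->
    0 <= x' -> 0 <= y' -> 0 < x' + y' -> x' * y < x * y' ->
  slope_gap x' y' < slope_gap x y.
Proof.
move=> x0 y0 xy x'0 y'0 xy' lt; rewrite /slope_gap.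
have dx A B : 0 < A -> 0 < B -> harm_dx A B x y < harm_dx A B x' y'.
  by move=> A0 B0; exact: harm_dx_lt.
have dy A B : 0 < A -> 0 < B -> harm_dy A B x' y' < harm_dy A B x y.
  by move=> A0 B0; exact: harm_dy_lt.
apply: ltrB; rewrite ltr_pM2r ?invr_gt0//;
  by apply: ltrD; rewrite ?ltrN2 ?ltrD2l ?ltrN2 ltr_pM2l// (dx, dy).
Qed.

Lemma need1_euler (x y : R) : 0 <= x -> 0 <= y -> 0 < x + y ->
  N1x x y * x + N1y x y * y = N1 x y.
Proof.
move=> x0 y0 xy; rewrite /need1 -(harm_euler A1_gt0 B1_gt0)// /need1_dx /need1_dy.
by ring.
Qed.

Lemma need2_euler (x y : R) : 0 <= x -> 0 <= y -> 0 < x + y ->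
  N2x x y * x + N2y x y * y = N2 x y.
Proof.
move=> x0 y0 xy; rewrite /need2 -(harm_euler A2_gt0 B2_gt0)// /need2_dx /need2_dy.
by ring.
Qed.

Lemma need1_tangent (x0 y0 x y : R) :
    0 <= x0 -> 0 <= y0 -> 0 < x0 + y0 -> 0 <= x -> 0 <= y ->
  N1x x0 y0 * x + N1y x0 y0 * y <= N1 x y ?= iff (y0 * x == x0 * y).
Proof.
move=> hx0 hy0 hxy0 hx hy.
have := harm_tangent A1_gt0 B1_gt0 x0 y0 x y hx0 hy0 hxy0 hx hy.
move=> /leifP H; apply/leifP; rewrite /need1 /need1_dx /need1_dy.
case: ifP H => _; first by move=> /eqP ->; apply/eqP; ring.
by rewrite -(ltr_pM2l ka1_gt0); lra.
Qed.

Lemma need2_tangent (x0 y0 x y : R) :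
    0 <= x0 -> 0 <= y0 -> 0 < x0 + y0 -> 0 <= x -> 0 <= y ->
  N2x x0 y0 * x + N2y x0 y0 * y <= N2 x y ?= iff (y0 * x == x0 * y).
Proof.
move=> hx0 hy0 hxy0 hx hy.
have := harm_tangent A2_gt0 B2_gt0 x0 y0 x y hx0 hy0 hxy0 hx hy.
move=> /leifP H; apply/leifP; rewrite /need2 /need2_dx /need2_dy.
case: ifP H => _; first by move=> /eqP ->; apply/eqP; ring.
by rewrite -(ltr_pM2l ka2_gt0); lra.
Qed.

(* First-order conditions for minimising max(0, N1) + max(0, N2) on the line
   b1 x + b2 y = const; a vanishing N_k leaves the subgradient of max(0, N_k)
   a choice in [0, 1]. *)
Definition stationary (x y : R) : Prop :=
  [\/ slope_gap x y = 0,
      N2 x y = 0 /\ slope_gap x y <= 0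
    | N1 x y = 0 /\ 0 <= slope_gap x y].

(** The root of the affine function with values f0 at 0 and f1 at 1 serves as the free subgradient
    coefficient of a vanishing N_k. *)
Lemma interp_root (f0 f1 : R) : 0 < f0 -> f1 <= 0 ->
  exists t, [/\ 0 <= t, t <= 1 & f0 + t * (f1 - f0) = 0].
Proof.
move=> h0 h1; exists (f0 / (f0 - f1)).
have d : 0 < f0 - f1 by lra.
split; first by rewrite divr_ge0// ltW.
- by rewrite ler_pdivrMr//; lra.
- by field; lra.
Qed.

(** If the slope gap is 0, both multipliers are 1. If N2 = 0, then s = 1 and t runs from 0, where
    the x-slope weighted by b2 exceeds the y-slope weighted by b1, to 1, where their difference is a
    positive multiple of the slope gap, hence at most 0. The case N1 = 0 exchanges the roles. *)
Lemma stationary_multipliers (x y : R) : 0 <= x -> 0 <= y -> 0 < x + y ->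
    0 < N1 x y + N2 x y -> stationary x y ->
  exists s t, [/\ 0 <= s <= 1, 0 <= t <= 1, 0 < s + t,
    (s * N1x x y + t * N2x x y) * b2 = (s * N1y x y + t * N2y x y) * b1
    & s * N1 x y + t * N2 x y = N1 x y + N2 x y].
Proof.
move=> x0 y0 xy N0.
have gapE : b1 * b2 * slope_gap x y =
    (N1x x y + N2x x y) * b2 - (N1y x y + N2y x y) * b1.
  by rewrite /slope_gap; field; rewrite !lt0r_neq0.
have bb : 0 < b1 * b2 by rewrite mulr_gt0.
have e1 := need1_euler x y x0 y0 xy; have e2 := need2_euler x y x0 y0 xy.
have N1y_le0 : N1y x y <= 0.
  rewrite oppr_le0 mulr_ge0//; first exact: ltW.
  by rewrite divr_ge0 ?sqr_ge0// mulr_ge0 ?sqr_ge0// ltW.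
have N2x_le0 : N2x x y <= 0.
  rewrite oppr_le0 mulr_ge0//; first exact: ltW.
  by rewrite divr_ge0 ?sqr_ge0// mulr_ge0 ?sqr_ge0// ltW.
case=> [g0|[n2 g0]|[n1 g0]].
- exists 1, 1; rewrite !mul1r ler01 lexx addr_gt0//; split=> //.
  by apply/eqP; rewrite -subr_eq0 -gapE g0 mulr0.
- have f0 : 0 < N1x x y * b2 - N1y x y * b1.
    (* By Euler's identity N1x * x + N1y * y = N1 > 0, and N1y <= 0. *)
    have : 0 < N1x x y * x by nra.
    move=> p; have N1x_gt0 : 0 < N1x x y.
      by rewrite ltNge; apply/negP => le; have := mulr_le0_ge0 le x0; lra.
    have := mulr_gt0 N1x_gt0 b2_gt0.
    by have := mulr_le0_ge0 N1y_le0 (ltW b1_gt0); lra.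
  have f1 : (N1x x y + N2x x y) * b2 - (N1y x y + N2y x y) * b1 <= 0.
    by rewrite -gapE pmulr_rle0.
  have [t [t0 t1 tE]] := interp_root _ _ f0 f1.
  exists 1, t; rewrite n2 mulr0 mul1r ler01 lexx t0 t1; split=> //; lra.
- have f0 : 0 < N2y x y * b1 - N2x x y * b2.
    have : 0 < N2y x y * y by nra.
    move=> p; have N2y_gt0 : 0 < N2y x y.
      by rewrite ltNge; apply/negP => le; have := mulr_le0_ge0 le y0; lra.
    have := mulr_gt0 N2y_gt0 b1_gt0.
    by have := mulr_le0_ge0 N2x_le0 (ltW b2_gt0); lra.
  have f1 : (N1y x y + N2y x y) * b1 - (N1x x y + N2x x y) * b2 <= 0.
    by have := mulr_ge0 (ltW bb) g0; rewrite gapE; lra.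
  have [s [s0 s1 sE]] := interp_root _ _ f0 f1.
  exists s, 1; rewrite n1 mulr0 mul1r ler01 lexx s0 s1; split=> //; lra.
Qed.

(** The tangent inequalities weighted by s and t bound g times the objective by mu1 + mu2, and at
    (x0, y0) that product equals N1 + N2. Equal objectives make a tangent inequality of positive
    weight tight, which puts (x, y) on the ray of (x0, y0). *)
Lemma stationary_optimal (x0 y0 x y mu1 mu2 : R) :
    0 <= x0 -> 0 <= y0 -> 0 < x0 + y0 -> 0 < N1 x0 y0 + N2 x0 y0 ->
    stationary x0 y0 -> 0 <= x -> 0 <= y -> 0 <= mu1 -> 0 <= mu2 ->
    N1 x y <= mu1 -> N2 x y <= mu2 -> mu1 + mu2 <= N1 x0 y0 + N2 x0 y0 ->
  b1 * x + b2 * y <= b1 * x0 + b2 * y0 /\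
  (b1 * x + b2 * y = b1 * x0 + b2 * y0 -> x = x0 /\ y = y0).
Proof.
move=> hx0 hy0 hxy0 N0 st hx hy hmu1 hmu2 n1 n2 hsum.
have [s [t [/andP[s0 s1] /andP[t0 t1] st0 grad stN]]] :=
  stationary_multipliers x0 y0 hx0 hy0 hxy0 N0 st.
have e1 := need1_euler x0 y0 hx0 hy0 hxy0.
have e2 := need2_euler x0 y0 hx0 hy0 hxy0.
have [t1le t1eq] := need1_tangent x0 y0 x y hx0 hy0 hxy0 hx hy.
have [t2le t2eq] := need2_tangent x0 y0 x y hx0 hy0 hxy0 hx hy.
pose g := (s * N1x x0 y0 + t * N2x x0 y0) / b1.
have gx : s * N1x x0 y0 + t * N2x x0 y0 = g * b1.
  by rewrite /g divfK// lt0r_neq0.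
have gy : s * N1y x0 y0 + t * N2y x0 y0 = g * b2.
  by apply: (mulIf (lt0r_neq0 b1_gt0)); rewrite -grad gx; ring.
have gE : g * (b1 * x0 + b2 * y0) = N1 x0 y0 + N2 x0 y0.
  by rewrite -stN -e1 -e2 mulrDr !mulrA -gx -gy; ring.
have lin : g * (b1 * x + b2 * y) =
    s * (N1x x0 y0 * x + N1y x0 y0 * y) + t * (N2x x0 y0 * x + N2y x0 y0 * y).
  by rewrite mulrDr !mulrA -gx -gy; ring.
have bp : 0 < b1 * x0 + b2 * y0.
  exact: harm_den_gt0.
have gp : 0 < g by rewrite -(pmulr_lgt0 _ bp) gE.
have smu : s * mu1 <= mu1 by rewrite ler_piMl.
have tmu : t * mu2 <= mu2 by rewrite ler_piMl.
have sn : s * N1 x y <= s * mu1 by rewrite ler_wpM2l.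
have tn : t * N2 x y <= t * mu2 by rewrite ler_wpM2l.
have st1 := ler_wpM2l s0 t1le; have st2 := ler_wpM2l t0 t2le.
split; first by rewrite -(ler_pM2l gp) gE lin; lra.
move=> eqb.
have par : y0 * x = x0 * y.
  have tot : g * (b1 * x + b2 * y) = N1 x0 y0 + N2 x0 y0 by rewrite eqb.
  rewrite lin in tot; apply/eqP.
  have [sp|sn0] := ltP 0 s.
    by rewrite -t1eq eq_le t1le -(ler_pM2l sp); lra.
  have tp : 0 < t by lra.
  by rewrite -t2eq eq_le t2le -(ler_pM2l tp); lra.
(* Proportional points with the same positive objective coincide. *)
split; apply: (mulIf (lt0r_neq0 bp)).
- by rewrite -{2}eqb; ring: par.
- by rewrite -{2}eqb; ring: par.
Qed.

End TwoUsers.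

(** * Continuity, and end-point values as limits along rays *)

Section Continuity.
Context {R : realType}.
Implicit Types (A B : R) (p : R * R).

Let cvg1 p : {for p, continuous (@fst R R)}. Proof. exact: cvg_fst. Qed.
Let cvg2 p : {for p, continuous (@snd R R)}. Proof. exact: cvg_snd. Qed.

Let continuous_harm_den A B p :
  {for p, continuous (fun q : R * R => A * q.1 + B * q.2)}.
Proof.
by apply: cvgD; apply: (cvgM (cvg_cst _)); [exact: cvg1 | exact: cvg2].
Qed.

Lemma continuous_harm_dx A B p : A * p.1 + B * p.2 != 0 ->
  {for p, continuous (fun q : R * R => harm_dx A B q.1 q.2)}.
Proof.
move=> D; apply: cvgM; first by apply: (cvgM (cvg_cst _)); apply: cvgM; exact: cvg2.
apply: cvgV; first by rewrite expf_neq0.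
by apply: cvgM; exact: continuous_harm_den.
Qed.

Lemma continuous_harm_dy A B p : A * p.1 + B * p.2 != 0 ->
  {for p, continuous (fun q : R * R => harm_dy A B q.1 q.2)}.
Proof.
move=> D; apply: cvgM; first by apply: (cvgM (cvg_cst _)); apply: cvgM; exact: cvg1.
apply: cvgV; first by rewrite expf_neq0.
by apply: cvgM; exact: continuous_harm_den.
Qed.

Lemma continuous_harm A B p : A * p.1 + B * p.2 != 0 ->
  {for p, continuous (fun q : R * R => harm A B q.1 q.2)}.
Proof.
move=> D; apply: cvgM; first by apply: cvgM; [exact: cvg1 | exact: cvg2].
by apply: cvgV => //; exact: continuous_harm_den.
Qed.

(* (dirx rho, diry rho) spans the ray of slope lambda_2 / lambda_1 = rho. *)
Definition dirx (rho : \bar R) : R := if rho == +oo%E then 0 else 1.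
Definition diry (rho : \bar R) : R := if rho == +oo%E then 1 else fine rho.

Lemma dirx_ge0 (rho : \bar R) : 0 <= dirx rho.
Proof. by rewrite /dirx; case: ifP. Qed.

Lemma diry_ge0 (rho : \bar R) : (0 <= rho)%E -> 0 <= diry rho.
Proof. by case: rho => // r; rewrite lee_fin. Qed.

Lemma dir_gt0 (rho : \bar R) : (0 <= rho)%E -> 0 < dirx rho + diry rho.
Proof.
case: rho => [r||]//; rewrite ?lee_fin /dirx /diry /= => r0.
  by rewrite ltr_pwDl.
by rewrite add0r ltr01.
Qed.

Lemma dir_lt (rho tau : \bar R) : (0 <= rho)%E -> (rho < tau)%E ->
  dirx tau * diry rho < dirx rho * diry tau.
Proof.
case: rho => [r||]//; case: tau => [t||]//; rewrite /dirx /diry /=.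
- by rewrite lte_fin !mul1r.
- by rewrite mul0r mul1r ltr01.
Qed.

(** Agreement is asked for positive arguments only: a formula containing 1 / rho takes a spurious
    value at 0, which the right limit replaces by that of the continuous g. *)
Lemma at_ext_right_limit (f g : R -> R) (r : R) : 0 <= r ->
  {for 0, continuous g} -> (forall s, 0 < s -> f s = g s) ->
  at_ext f r%:E = g r.
Proof.
move=> r0 gc fg /=; case: eqVneq => [->|rn0]; last first.
  by rewrite fg// lt_neqAle eq_sym rn0.
apply/cvg_lim => //.
have : g x @[x --> 0^'+] --> g 0 by exact: cvg_at_right_filter.
apply: cvg_trans; apply: near_eq_cvg.
by near=> s; rewrite fg.
Unshelve. all: by end_near. Qed.

Lemma cvg_curve {T : Type} (F : set_system T) (FF : Filter F) (u v : T -> R)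
    (a b : R) : u x @[x --> F] --> a -> v x @[x --> F] --> b ->
  (u x, v x) @[x --> F] --> ((a, b) : R * R).
Proof. by move=> ua vb; exact: (cvg_pair ua vb). Qed.

(** By homogeneity of degree 0, Phi 1 x = Phi x^-1 1 for x > 0, so the limit at +oo is a matter of
    continuity at (0, 1). *)
Lemma at_ext_dir (f : R -> R) (Phi : R -> R -> R) (rho : \bar R) :
    (forall r, 0 < r -> f r = Phi 1 r) ->
    (forall t x y, t != 0 -> Phi (t * x) (t * y) = Phi x y) ->
    (forall p : R * R, 0 <= p.1 -> 0 <= p.2 -> 0 < p.1 + p.2 ->
      {for p, continuous (fun q : R * R => Phi q.1 q.2)}) ->
  (0 <= rho)%E -> at_ext f rho = Phi (dirx rho) (diry rho).
Proof.
move=> fPhi hom cont; case: rho => [r||]//.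
  rewrite lee_fin => r0; rewrite (@at_ext_right_limit f (Phi 1))//.
  have path : (1, y) @[y --> (0 : R)] --> ((1, 0) : R * R).
    by apply: cvg_curve; [exact: cvg_cst | exact: cvg_id].
  by apply: (cvg_comp _ _ path (cont (1, 0) _ _ _)) => //=; rewrite addr0.
move=> _; rewrite /dirx /diry eqxx /=; apply/cvg_lim => //.
have inv0 : x^-1 @[x --> (+oo : set_system R)] --> (0 : R).
  by apply/gtr0_cvgV0; [exact: nbhs_pinfty_gt | exact: cvg_id].
have : Phi x^-1 1 @[x --> (+oo : set_system R)] --> Phi 0 1.
  have path : (x^-1, 1) @[x --> (+oo : set_system R)] --> ((0, 1) : R * R).
    by apply: cvg_curve; [exact: inv0 | exact: cvg_cst].
  by apply: (cvg_comp _ _ path (cont (0, 1) _ _ _)) => //=; rewrite add0r.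
apply: cvg_trans; apply: near_eq_cvg; near=> x.
have x0 : 0 < x by near: x; exact: nbhs_pinfty_gt.
by rewrite fPhi// -(hom x x^-1 1) ?lt0r_neq0// mulfV ?lt0r_neq0// mulr1.
Unshelve. all: by end_near. Qed.

End Continuity.

(** * Reduction of the dual constraints to N_1 and N_2 *)

Section Dual.
Context {R : realType} {beta gamma : 'I_2 -> R} {eps : 'I_2 -> 'I_2 -> R}.
Hypotheses (beta_gt0 : forall k, 0 < beta k) (gamma_gt0 : forall k, 0 < gamma k).
Hypotheses (eps_gt0 : forall j k, 0 < eps j k) (c_gt0 : forall k, 0 < c beta gamma k).

Local Notation al1 := (eps k1 k1 * c beta gamma k1 / gamma k1).
Local Notation ka1 := (beta k2 * eps k1 k1 * eps k2 k1).
Local Notation A1 := (eps k1 k1).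
Local Notation B1 := (eps k2 k1 * gamma k1).
Local Notation al2 := (eps k2 k2 * c beta gamma k2 / gamma k2).
Local Notation ka2 := (beta k1 * eps k2 k2 * eps k1 k2).
Local Notation A2 := (eps k1 k2 * gamma k2).
Local Notation B2 := (eps k2 k2).
Local Notation N1 := (need1 al1 ka1 A1 B1).
Local Notation N2 := (need2 al2 ka2 A2 B2).
Local Notation gap :=
  (@slope_gap R al1 ka1 A1 B1 al2 ka2 A2 B2 (beta k1) (beta k2)).
Local Notation stat :=
  (@stationary R al1 ka1 A1 B1 al2 ka2 A2 B2 (beta k1) (beta k2)).
Local Notation lo := (rho_lo beta gamma eps).
Local Notation hi := (rho_hi beta gamma eps).

Let al1_gt0 : 0 < al1. Proof. by rewrite divr_gt0// mulr_gt0. Qed.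
Let al2_gt0 : 0 < al2. Proof. by rewrite divr_gt0// mulr_gt0. Qed.
Let ka1_gt0 : 0 < ka1. Proof. by rewrite !mulr_gt0. Qed.
Let ka2_gt0 : 0 < ka2. Proof. by rewrite !mulr_gt0. Qed.
Let B1_gt0 : 0 < B1. Proof. by rewrite mulr_gt0. Qed.
Let A2_gt0 : 0 < A2. Proof. by rewrite mulr_gt0. Qed.

Lemma ord2_cases (k : 'I_2) : k = k1 \/ k = k2.
Proof. by case: k => -[|[|//]] i; [left | right]; exact: val_inj. Qed.

Lemma forall_ord2 (P : 'I_2 -> Prop) : (forall k, P k) <-> P k1 /\ P k2.
Proof. by split=> [//|[P1 P2] k]; case: (ord2_cases k) => ->. Qed.

Lemma sum_ord2 (f : 'I_2 -> R) : \sum_(k < 2) f k = f k1 + f k2.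
Proof.
by rewrite !big_ord_recl big_ord0 addr0; congr (f _ + f _); exact: val_inj.
Qed.

Lemma need1_0 (y : R) : N1 0 y = 0.
Proof. by rewrite /need1 /harm !(mul0r, mulr0) subr0. Qed.

Lemma need2_0 (x : R) : N2 x 0 = 0.
Proof. by rewrite /need2 /harm !(mul0r, mulr0) subr0. Qed.

Lemma mu_star1E (lam : 'I_2 -> R) :
  mu_star beta gamma eps lam k1 = N1 (lam k1) (lam k2).
Proof.
rewrite /mu_star eqxx /need1 /harm.
have -> : eps k1 k1 * lam k1 + eps k2 k1 * lam k2 * gamma k1 =
  eps k1 k1 * lam k1 + B1 * lam k2 by ring.
by move: (_ + _)^-1 => i; move: (gamma k1)^-1 => j; ring.
Qed.

Lemma mu_star2E (lam : 'I_2 -> R) :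
  mu_star beta gamma eps lam k2 = N2 (lam k1) (lam k2).
Proof.
rewrite /mu_star /= /need2 /harm.
have -> : eps k2 k2 * lam k2 + eps k1 k2 * lam k1 * gamma k2 =
  A2 * lam k1 + eps k2 k2 * lam k2 by ring.
by move: (_ + _)^-1 => i; move: (gamma k2)^-1 => j; ring.
Qed.

Let c_split (k : 'I_2) :
  beta k * gamma k / (1 + gamma k) = 1 - c beta gamma k.
Proof. by rewrite /c; ring. Qed.

(** At m = gamma_1 / (eps_11 lambda_1) the own term of the load is beta_1 gamma_1 / (1 + gamma_1) =
    1 - c_1, and load - 1 factors as (mu1 - N1) m. For lambda_1 = 0 both sides hold. *)
Lemma le_F1 (mu1 : R) (lam : 'I_2 -> R) : (forall k, 0 <= lam k) -> 0 <= mu1 ->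
  ((lam k1)%:E <= F beta gamma eps lam mu1 k1)%E <->
  N1 (lam k1) (lam k2) <= mu1.
Proof.
move=> lam0 mu0; rewrite (le_F beta_gt0 gamma_gt0 eps_gt0 lam0 mu0).
have := lam0 k1; rewrite le_eqVlt => /predU1P[z|l1].
  by rewrite -z need1_0; split=> // _; left.
have e0 := eps_gt0 k1 k1; have g0 := gamma_gt0 k1.
have D : 0 < A1 * lam k1 + B1 * lam k2.
  by apply: harm_den_gt0 => //; exact: ltr_pwDl.
have eq : load beta (fun j => lam j * eps j k1) mu1
    (gamma k1 / (eps k1 k1 * lam k1)) - 1 =
  (mu1 - N1 (lam k1) (lam k2)) * (gamma k1 / (eps k1 k1 * lam k1)).
  rewrite /load sum_ord2 /need1 /harm.
  have -> : lam k1 * eps k1 k1 * (gamma k1 / (eps k1 k1 * lam k1)) = gamma k1.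
    by field; rewrite !lt0r_neq0.
  rewrite mulrA c_split.
  by field; rewrite !lt0r_neq0.
rewrite -[1 <= _]subr_ge0 eq pmulr_lge0 ?divr_gt0 ?mulr_gt0// subr_ge0.
by split=> [[z|//]|]; [move: l1; rewrite z ltxx | right].
Qed.

Lemma le_F2 (mu2 : R) (lam : 'I_2 -> R) : (forall k, 0 <= lam k) -> 0 <= mu2 ->
  ((lam k2)%:E <= F beta gamma eps lam mu2 k2)%E <->
  N2 (lam k1) (lam k2) <= mu2.
Proof.
move=> lam0 mu0; rewrite (le_F beta_gt0 gamma_gt0 eps_gt0 lam0 mu0).
have := lam0 k2; rewrite le_eqVlt => /predU1P[z|l2].
  by rewrite -z need2_0; split=> // _; left.
have e0 := eps_gt0 k2 k2; have g0 := gamma_gt0 k2.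
have D : 0 < A2 * lam k1 + B2 * lam k2.
  by apply: harm_den_gt0 => //; exact: ltr_wpDl.
have eq : load beta (fun j => lam j * eps j k2) mu2
    (gamma k2 / (eps k2 k2 * lam k2)) - 1 =
  (mu2 - N2 (lam k1) (lam k2)) * (gamma k2 / (eps k2 k2 * lam k2)).
  rewrite /load sum_ord2 /need2 /harm.
  have -> : lam k2 * eps k2 k2 * (gamma k2 / (eps k2 k2 * lam k2)) = gamma k2.
    by field; rewrite !lt0r_neq0.
  rewrite [beta k2 * _]mulrA c_split.
  by field; rewrite !lt0r_neq0.
rewrite -[1 <= _]subr_ge0 eq pmulr_lge0 ?divr_gt0 ?mulr_gt0// subr_ge0.
by split=> [[z|//]|]; [move: l2; rewrite z ltxx | right].
Qed.


Lemma dual_constraintsE (mu lam : 'I_2 -> R) :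
  dual_constraints beta gamma eps mu lam <->
  [/\ forall k, 0 <= mu k, forall k, 0 <= lam k, mu k1 + mu k2 <= 2,
      N1 (lam k1) (lam k2) <= mu k1 & N2 (lam k1) (lam k2) <= mu k2].
Proof.
split=> [[mu0 lam0 s /forall_ord2[]]|[mu0 lam0 s n1 n2]].
  rewrite (le_F1 _ _ lam0 (mu0 _)) (le_F2 _ _ lam0 (mu0 _)) => n1 n2.
  by split=> //; move: s; rewrite sum_ord2; lra.
split=> //; first by rewrite sum_ord2; lra.
by apply/forall_ord2; rewrite (le_F1 _ _ lam0 (mu0 _)) (le_F2 _ _ lam0 (mu0 _)).
Qed.

(** * Values of g_1, g_2 and h in homogeneous coordinates *)

Let den_neq0 A B (p : R * R) : 0 < A -> 0 < B -> 0 <= p.1 -> 0 <= p.2 ->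
  0 < p.1 + p.2 -> A * p.1 + B * p.2 != 0.
Proof. by move=> *; apply/lt0r_neq0/harm_den_gt0. Qed.

Let slope_dx (x y : R) :=
  (need1_dx al1 ka1 A1 B1 x y + need2_dx ka2 A2 B2 x y) / beta k1.
Let slope_dy (x y : R) :=
  (need1_dy ka1 A1 B1 x y + need2_dy al2 ka2 A2 B2 x y) / beta k2.

Let continuous_slope_dx (p : R * R) : 0 <= p.1 -> 0 <= p.2 -> 0 < p.1 + p.2 ->
  {for p, continuous (fun q : R * R => slope_dx q.1 q.2)}.
Proof.
move=> p1 p2 p12; apply: cvgM; last exact: cvg_cst.
apply: cvgD; first apply: (cvgB (cvg_cst _)); last apply: cvgN.
  by apply: (cvgM (cvg_cst _)); exact/continuous_harm_dx/den_neq0.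
by apply: (cvgM (cvg_cst _)); exact/continuous_harm_dx/den_neq0.
Qed.

Let continuous_slope_dy (p : R * R) : 0 <= p.1 -> 0 <= p.2 -> 0 < p.1 + p.2 ->
  {for p, continuous (fun q : R * R => slope_dy q.1 q.2)}.
Proof.
move=> p1 p2 p12; apply: cvgM; last exact: cvg_cst.
apply: cvgD; last apply: (cvgB (cvg_cst _)); first apply: cvgN.
  by apply: (cvgM (cvg_cst _)); exact/continuous_harm_dy/den_neq0.
by apply: (cvgM (cvg_cst _)); exact/continuous_harm_dy/den_neq0.
Qed.

Lemma continuous_gap (p : R * R) : 0 <= p.1 -> 0 <= p.2 -> 0 < p.1 + p.2 ->
  {for p, continuous (fun q : R * R => gap q.1 q.2)}.
Proof.
move=> p1 p2 p12.
by apply: cvgB; [exact: continuous_slope_dx | exact: continuous_slope_dy].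
Qed.

Lemma at_ext_g1 (rho : \bar R) : (0 <= rho)%E ->
  at_ext (g1 beta gamma eps) rho = slope_dx (dirx rho) (diry rho).
Proof.
apply: at_ext_dir => // [r r0|t x y t0].
  have d1 : 0 < A1 + B1 * r by rewrite ltr_pwDl ?mulr_ge0 ?ltW.
  have d2 : 0 < A2 + B2 * r by rewrite ltr_pwDl ?mulr_ge0 ?ltW.
  rewrite /g1 /slope_dx /need1_dx /need2_dx /harm_dx !mulr1.
  have -> : eps k1 k1 * (1 / r) + eps k2 k1 * gamma k1 = (A1 + B1 * r) / r.
    by field; rewrite lt0r_neq0.
  have -> : eps k2 k2 + 1 / r * eps k1 k2 * gamma k2 = (A2 + B2 * r) / r.
    by field; rewrite lt0r_neq0.
  by field; rewrite !lt0r_neq0.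
rewrite /slope_dx /need1_dx /need2_dx !harm_dx_scale//.
Qed.

Lemma at_ext_g2 (rho : \bar R) : (0 <= rho)%E ->
  at_ext (g2 beta gamma eps) rho = slope_dy (dirx rho) (diry rho).
Proof.
apply: at_ext_dir => // [r r0|t x y t0].
  have d1 : 0 < A1 + B1 * r by rewrite ltr_pwDl ?mulr_ge0 ?ltW.
  have d2 : 0 < A2 + B2 * r by rewrite ltr_pwDl ?mulr_ge0 ?ltW.
  rewrite /g2 /slope_dy /need1_dy /need2_dy /harm_dy !mulr1 expr1n !mulr1.
  have -> : eps k2 k2 * r + eps k1 k2 * gamma k2 = A2 + B2 * r by ring.
  have -> : eps k1 k1 + r * eps k2 k1 * gamma k1 = A1 + B1 * r by ring.
  by field; rewrite !lt0r_neq0.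
rewrite /slope_dy /need1_dy /need2_dy !harm_dy_scale//.
Qed.

Lemma at_ext_gap (rho : \bar R) : (0 <= rho)%E ->
  at_ext (g1 beta gamma eps) rho - at_ext (g2 beta gamma eps) rho =
  gap (dirx rho) (diry rho).
Proof. by move=> r0; rewrite at_ext_g1// at_ext_g2. Qed.

(** N1 + N2 has degree 1, so [at_ext_dir] does not apply; the limit at 0 comes from continuity along
    the points (1, y). *)
Lemma at_ext_h (r : R) : 0 <= r ->
  at_ext (h beta gamma eps) r%:E = N1 1 r + N2 1 r.
Proof.
move=> r0; rewrite (@at_ext_right_limit _ _ (fun s => N1 1 s + N2 1 s))//.
  have path : (1, y) @[y --> (0 : R)] --> ((1, 0) : R * R).
    by apply: cvg_curve; [exact: cvg_cst | exact: cvg_id].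
  have ch A B : 0 < A -> 0 < B -> harm A B 1 y @[y --> (0 : R)] --> harm A B 1 0.
    move=> A0 B0; apply: (cvg_comp _ _ path (@continuous_harm _ A B (1, 0) _)).
    by rewrite /= mulr0 addr0 mulr1 lt0r_neq0.
  apply: cvgD; first apply: (cvgB (cvg_cst _)).
    by apply: (cvgM (cvg_cst _)); exact: ch.
  apply: cvgB; first exact: (cvgM (cvg_cst _) cvg_id).
  by apply: (cvgM (cvg_cst _)); exact: ch.
move=> s s0; have d1 : 0 < A1 + B1 * s by rewrite ltr_pwDl ?mulr_ge0 ?ltW.
have d2 : 0 < A2 + B2 * s by rewrite ltr_pwDl ?mulr_ge0 ?ltW.
rewrite /h /need1 /need2 /harm !mulr1.
have -> : eps k2 k2 * s + eps k1 k2 * gamma k2 = A2 + B2 * s by ring.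
have -> : eps k1 k1 + s * eps k2 k1 * gamma k1 = A1 + B1 * s by ring.
by field; rewrite !lt0r_neq0.
Qed.

(** * Signs of N_1 and N_2 along rays, and the thresholds *)

Let ray_den_gt0 (A B r : R) : 0 < A -> 0 < B -> 0 <= r -> 0 < A + B * r.
Proof. by move=> A0 B0 r0; rewrite ltr_pwDl// mulr_ge0// ltW. Qed.

(** The affine factor carries the sign; its zero is [rho_hi] where that is finite. For N2 below, the
    zero of the affine factor is [rho_lo] where beta_1 > c_2. *)
Lemma need1_ray (r : R) : 0 <= r ->
  N1 1 r = eps k1 k1 / (gamma k1 * (A1 + B1 * r)) *
    (eps k1 k1 * c beta gamma k1 -
     gamma k1 * eps k2 k1 * (beta k2 - c beta gamma k1) * r).
Proof.
move=> r0; have D : 0 < A1 + B1 * r by rewrite ray_den_gt0// ltW.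
by rewrite /need1 /harm !mulr1; field; rewrite !lt0r_neq0.
Qed.

Lemma need2_ray (r : R) : 0 <= r ->
  N2 1 r = r * eps k2 k2 / (gamma k2 * (A2 + B2 * r)) *
    (eps k2 k2 * c beta gamma k2 * r -
     eps k1 k2 * gamma k2 * (beta k1 - c beta gamma k2)).
Proof.
move=> r0; have D : 0 < A2 + B2 * r by rewrite ray_den_gt0// ltW.
by rewrite /need2 /harm !mulr1; field; rewrite !lt0r_neq0.
Qed.

Let dir_fin (r : R) : (dirx r%:E = 1) * (diry r%:E = r).
Proof. by []. Qed.

Let dir_pinfty : (dirx (+oo%E : \bar R) = 0) * (diry (+oo%E : \bar R) = 1).
Proof. by rewrite /dirx /diry eqxx. Qed.

Lemma need1_dir_gt0 (rho : \bar R) : (0 <= rho)%E ->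
  (0 < N1 (dirx rho) (diry rho)) = (rho < hi)%E.
Proof.
case: rho => [r|_|//]; last first.
  by rewrite !dir_pinfty need1_0 ltxx [RHS]ltNge leey.
rewrite lee_fin !dir_fin => r0; rewrite need1_ray//.
have D : 0 < A1 + B1 * r by rewrite ray_den_gt0// ltW.
rewrite pmulr_rgt0 ?divr_gt0 ?mulr_gt0// subr_gt0 /rho_hi.
case: ifPn => [c1|].
  rewrite ltry; apply: (@le_lt_trans _ _ 0); last exact: mulr_gt0.
  rewrite mulr_le0_ge0// mulr_ge0_le0//; last by lra.
  by rewrite ltW// mulr_gt0.
rewrite -ltNge => c1; rewrite lte_fin ltr_pdivlMr 1?mulrC//.
by rewrite !mulr_gt0//; lra.
Qed.

Lemma need2_dir_gt0 (rho : \bar R) : (0 <= rho)%E ->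
  (0 < N2 (dirx rho) (diry rho)) = (lo < rho)%E.
Proof.
case: rho => [r|_|//]; last first.
  rewrite !dir_pinfty /need2 /harm !(mul0r, mulr0) subr0 mulr1 al2_gt0.
  by rewrite /rho_lo; case: ifP => _; rewrite ltry.
rewrite lee_fin !dir_fin le_eqVlt => /predU1P[<-|r0].
  rewrite need2_0 ltxx /rho_lo; case: ifPn => [c2|]; first by rewrite ltxx.
  rewrite -ltNge => c2; apply/esym/negbTE; rewrite lte_fin -leNgt.
  by rewrite mulr_ge0 ?divr_ge0 ?mulr_ge0 ?ltW//; lra.
have D : 0 < A2 + B2 * r by rewrite ray_den_gt0// ltW.
have ec : 0 < eps k2 k2 * c beta gamma k2 by rewrite mulr_gt0.
rewrite need2_ray 1?ltW// pmulr_rgt0 ?divr_gt0 ?mulr_gt0// subr_gt0 /rho_lo.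
case: ifPn => c2.
  rewrite lte_fin r0; apply: (@le_lt_trans _ _ 0); last exact: mulr_gt0.
  apply: mulr_ge0_le0; [by rewrite ltW// mulr_gt0 | lra].
by rewrite lte_fin [X in _ = (X < _)]mulrAC ltr_pdivrMr// [r * _]mulrC.
Qed.

Lemma rho_lo_ge0 : (0 <= lo)%E.
Proof.
rewrite /rho_lo; case: ifPn => //; rewrite -ltNge lee_fin => c2.
by rewrite mulr_ge0 ?divr_ge0 ?mulr_ge0 ?ltW//; lra.
Qed.

Lemma rho_hi_gt0 : (0 < hi)%E.
Proof.
by rewrite -need1_dir_gt0// !dir_fin /need1 /harm !(mulr0, mul0r) subr0 mulr1.
Qed.

Lemma need1_dir_hi : N1 (dirx hi) (diry hi) = 0.
Proof.
have := rho_hi_gt0; rewrite /rho_hi; case: ifPn => [c1|].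
  by rewrite dir_pinfty need1_0.
rewrite -ltNge lte_fin !dir_fin => c1 /ltW r0; rewrite need1_ray//.
apply/eqP; rewrite mulf_eq0 subr_eq0; apply/orP; right; apply/eqP.
by field; rewrite !lt0r_neq0//; lra.
Qed.

Lemma need2_dir_lo : N2 (dirx lo) (diry lo) = 0.
Proof.
have := rho_lo_ge0; rewrite /rho_lo; case: ifPn => c2.
  by rewrite !dir_fin need2_0.
rewrite lee_fin !dir_fin => r0; rewrite need2_ray//.
apply/eqP; rewrite mulf_eq0 subr_eq0; apply/orP; right; apply/eqP.
by field; rewrite !lt0r_neq0.
Qed.

Lemma rho_lo_fin : exists2 r, lo = r%:E & 0 <= r.
Proof.
have := rho_lo_ge0; rewrite /rho_lo; case: ifPn => _ r0.
  by exists 0.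
by eexists; [reflexivity | rewrite -lee_fin].
Qed.

(** If hi <= lo, then N1 <= 0 and N2 = 0 on the ray of lo, so all its multiples are admissible with
    mu = 0 and the objective is unbounded. *)
Lemma rho_lo_lt_hi (sigma2 : R) : 0 < sigma2 ->
  dual_feasible sigma2 beta gamma eps -> (lo < hi)%E.
Proof.
move=> sigma_gt0 feas; rewrite ltNge; apply/negP => hilo.
have [r loE r0] := rho_lo_fin.
have n1 : N1 1 r <= 0.
  by rewrite leNgt -[1](dir_fin r).1 -[X in N1 _ X](dir_fin r).2
    need1_dir_gt0 -?loE ?rho_lo_ge0// -leNgt.
have n2 : N2 1 r = 0 by have := need2_dir_lo; rewrite loE !dir_fin.
pose S := beta k1 + beta k2 * r.
have S0 : 0 < S by rewrite ltr_pwDl// mulr_ge0// ltW.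
have big (T : R) : 0 < T -> ((sigma2 * (T * S))%:E <= dual_value sigma2 beta gamma eps)%E.
  move=> T0; apply: ereal_sup_ubound.
  exists (fun=> 0), (fun k => if k == k1 then T * 1 else T * r).
  split.
    apply/dual_constraintsE; split=> //=.
    - by move=> k; case: ifP; rewrite mulr_ge0// ltW.
    - by rewrite addr0 ler0n.
    - by rewrite need1_scale ?lt0r_neq0// pmulr_rle0.
    - by rewrite need2_scale ?lt0r_neq0// n2 mulr0.
  by congr EFin; rewrite /dual_objective sum_ord2 /= /S; ring.
move: feas; rewrite /dual_feasible; move: big.
case: (dual_value _ _ _ _) => [v big _|big|big]//.
have vT : 0 < `|v| + 1 by rewrite ltr_wpDl.
(* This T makes the objective [|v|] + 1, beyond the supposed optimal value v. *)
have := big _ (divr_gt0 vT (mulr_gt0 sigma_gt0 S0)).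
have -> : sigma2 * ((`|v| + 1) / (sigma2 * S) * S) = `|v| + 1.
  by field; rewrite !lt0r_neq0.
by rewrite lee_fin => h; have := ler_norm v; lra.
Qed.

(** * Existence and uniqueness of rho^*, and optimality of the resulting pair *)

Local Notation G rho := (gap (dirx rho) (diry rho)).

Lemma gap_dir_lt (rho tau : \bar R) : (0 <= rho)%E -> (rho < tau)%E ->
  G tau < G rho.
Proof.
move=> r0 rt; have t0 : (0 <= tau)%E by exact: le_trans (ltW rt).
by apply: slope_gap_lt => //;
  rewrite ?(dirx_ge0, diry_ge0, dir_gt0)//; exact: dir_lt.
Qed.

(** The intermediate value theorem is applied on the segment between the two directions instead of
    in rho, so that hi = +oo is covered; the segment avoids the origin. *)
Lemma gap_root : (lo < hi)%E -> 0 < G lo -> G hi < 0 ->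
  exists2 rho : \bar R, (0 <= rho)%E & G rho = 0.
Proof.
move=> lohi Glo Ghi; have [l loE l0] := rho_lo_fin.
have hi0 : (0 <= hi)%E by exact: ltW rho_hi_gt0.
pose u t := 1 - t + t * dirx hi; pose v t := (1 - t) * l + t * diry hi.
have u0 t : 0 <= t -> t <= 1 -> 0 <= u t.
  by move=> t0 t1; rewrite addr_ge0 ?mulr_ge0 ?dirx_ge0//; lra.
have v0 t : 0 <= t -> t <= 1 -> 0 <= v t.
  by move=> t0 t1; rewrite addr_ge0 ?mulr_ge0 ?diry_ge0//; lra.
have uv0 t : 0 <= t -> t <= 1 -> 0 < u t + v t.
  rewrite le_eqVlt => /predU1P[<- _|t0 t1].
    by rewrite /u /v !mul0r subr0 mul1r !addr0 ltr_pwDl.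
  have -> : u t + v t = (1 - t) * (1 + l) + t * (dirx hi + diry hi).
    by rewrite /u /v; ring.
  by apply: ltr_wpDl; rewrite ?mulr_ge0 ?mulr_gt0 ?dir_gt0//; lra.
have [||t] := @IVT R (fun t => gap (u t) (v t)) 0 1 0 ler01.
- apply: continuous_in_subspaceT => t; rewrite inE/= in_itv/= => /andP[t0 t1].
  have lin (a b : R) : (1 - s) * a + s * b @[s --> t] --> (1 - t) * a + t * b.
    apply: cvgD; last exact: (cvgM cvg_id (cvg_cst _)).
    by apply: cvgM (cvg_cst _); exact: (cvgB (cvg_cst _) cvg_id).
  have path : (u s, v s) @[s --> t] --> ((u t, v t) : R * R).
    apply: cvg_curve; last exact: lin.
    by apply: cvgD; [exact: (cvgB (cvg_cst _) cvg_id)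
                    | exact: (cvgM cvg_id (cvg_cst _))].
  by apply: (cvg_comp _ _ path (continuous_gap (u t, v t) _ _ _)) => /=;
    [exact: u0 | exact: v0 | exact: uv0].
- rewrite /u /v !mul0r subr0 mul1r !addr0 subrr !mul0r !mul1r !add0r.
  move: Glo; rewrite loE /dirx /diry /= => Glo.
  by rewrite ge_min le_max (ltW Glo) (ltW Ghi) orbT.
rewrite in_itv/= => /andP[t0 t1] Gt.
(* u can vanish only at t = 1, where the gap is negative. *)
have t_lt1 : t < 1.
  rewrite lt_neqAle t1 andbT; apply: contraTneq Ghi => tE.
  by move: Gt; rewrite tE /u /v subrr !mul0r !add0r !mul1r => ->; rewrite ltxx.
have up : 0 < u t by rewrite ltr_pwDl ?mulr_ge0 ?dirx_ge0//; lra.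
exists (v t / u t)%:E; first by rewrite lee_fin divr_ge0 ?v0 ?u0.
rewrite /dirx /diry /= -Gt -(slope_gap_scale (u t)^-1 (u t)) ?invr_neq0 ?lt0r_neq0//.
by rewrite mulVf ?lt0r_neq0// [_^-1 * _]mulrC.
Qed.

Lemma is_rho_starE (rho : \bar R) : is_rho_star beta gamma eps rho <->
  if (G lo <= 0) && (G hi < 0) then rho = lo
  else if (0 < G lo) && (0 <= G hi) then rho = hi
  else (0 <= rho)%E /\ G rho = 0.
Proof.
have lo0 := rho_lo_ge0; have hi0 : (0 <= hi)%E by exact: ltW rho_hi_gt0.
rewrite /is_rho_star !at_ext_gap//; case: ifP => // _; case: ifP => // _.
split=> -[r0]; rewrite -at_ext_gap//.
  by move=> ->; rewrite subrr.
by move=> /eqP; rewrite subr_eq0 => /eqP.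
Qed.

(** Since G hi < G lo, the third case of the definition means G hi < 0 < G lo. A root then exists,
    and strict decrease makes it the only one in [0, +oo]. *)
Lemma rho_star_uniqueness : (lo < hi)%E ->
  exists! rho : \bar R, is_rho_star beta gamma eps rho.
Proof.
move=> lohi; have hl := gap_dir_lt lo hi rho_lo_ge0 lohi.
suff [rho [rP rU]] : exists rho, is_rho_star beta gamma eps rho /\
    forall tau, is_rho_star beta gamma eps tau -> rho = tau by exists rho.
have [c1|c1] := boolP ((G lo <= 0) && (G hi < 0)).
  by exists lo; split=> [|tau]; rewrite is_rho_starE c1 // => ->.
have [c2|c2] := boolP ((0 < G lo) && (0 <= G hi)).
  by exists hi; split=> [|tau]; rewrite is_rho_starE (negbTE c1) c2 // => ->.
have Glo : 0 < G lo.
  by rewrite ltNge; apply: contraNN c1 => G0; rewrite G0 (lt_le_trans hl).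
have Ghi : G hi < 0.
  by rewrite ltNge; apply: contraNN c2 => G0; rewrite G0 Glo.
have [rho r0 Gr] := gap_root lohi Glo Ghi.
exists rho; split=> [|tau];
  rewrite is_rho_starE (negbTE c1) (negbTE c2)// => -[t0 Gt].
case: (ltgtP rho tau) => // lt.
  by have := gap_dir_lt rho tau r0 lt; rewrite Gr Gt ltxx.
by have := gap_dir_lt tau rho t0 lt; rewrite Gr Gt ltxx.
Qed.

(** At an end point one N_k vanishes, lo < hi makes the other positive, and the sign of G is the one
    that [stationary] asks for. In the third case strict decrease of G places rho strictly between
    lo and hi, where both are positive. *)
Lemma rho_star_stationary (rho : \bar R) : (lo < hi)%E ->
    is_rho_star beta gamma eps rho ->
  [/\ (0 <= rho)%E, 0 <= N1 (dirx rho) (diry rho),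
      0 <= N2 (dirx rho) (diry rho),
      0 < N1 (dirx rho) (diry rho) + N2 (dirx rho) (diry rho)
    & stat (dirx rho) (diry rho)].
Proof.
move=> lohi; have hl := gap_dir_lt lo hi rho_lo_ge0 lohi.
have lo0 := rho_lo_ge0; have hi0 : (0 <= hi)%E by exact: ltW rho_hi_gt0.
have n1lo : 0 < N1 (dirx lo) (diry lo) by rewrite need1_dir_gt0.
have n2hi : 0 < N2 (dirx hi) (diry hi) by rewrite need2_dir_gt0.
rewrite is_rho_starE; case: ifPn => [/andP[Glo _] ->|c1].
  rewrite need2_dir_lo addr0; split=> //; first exact: ltW.
  by apply: Or32; rewrite need2_dir_lo.
case: ifPn => [/andP[_ Ghi] ->|c2 [r0 Gr]].
  rewrite need1_dir_hi add0r; split=> //; first exact: ltW.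
  by apply: Or33; rewrite need1_dir_hi.
have Glo : 0 < G lo.
  by rewrite ltNge; apply: contraNN c1 => G0; rewrite G0 (lt_le_trans hl).
have Ghi : G hi < 0.
  by rewrite ltNge; apply: contraNN c2 => G0; rewrite G0 Glo.
have n1 : 0 < N1 (dirx rho) (diry rho).
  rewrite need1_dir_gt0// ltNge le_eqVlt; apply/negP => /predU1P[hiE|lt].
    by move: Ghi; rewrite hiE Gr ltxx.
  by have := gap_dir_lt hi rho hi0 lt; rewrite Gr; lra.
have n2 : 0 < N2 (dirx rho) (diry rho).
  rewrite need2_dir_gt0// ltNge le_eqVlt; apply/negP => /predU1P[loE|lt].
    by move: Glo; rewrite -loE Gr ltxx.
  by have := gap_dir_lt rho lo r0 lt; rewrite Gr; lra.
by split=> //; [exact: ltW | exact: ltW | exact: addr_gt0 | exact: Or31].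
Qed.

(** T scales the direction so that N1 + N2 becomes 2. For rho = +oo one has N1 = 0 and N2 = eps_22
    c_2 / gamma_2, which gives the separate formula. *)
Lemma lam_starE (rho : \bar R) : (0 <= rho)%E ->
  let T := 2 / (N1 (dirx rho) (diry rho) + N2 (dirx rho) (diry rho)) in
  lam_star beta gamma eps rho k1 = T * dirx rho /\
  lam_star beta gamma eps rho k2 = T * diry rho.
Proof.
case: rho => [r r0|_|//]; rewrite /lam_star.
  rewrite at_ext_h// !dir_fin /=; split; first by rewrite mulr1.
  by rewrite mulrAC.
rewrite /=.
rewrite !dir_pinfty mulr0 need1_0 add0r /need2 /harm !(mul0r, mulr0) subr0 !mulr1.
by split=> //; field; rewrite !lt0r_neq0.
Qed.

(** Scaling preserves stationarity, and N1 + N2 = 2 exhausts the budget for mu, so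
    [stationary_optimal] applies to every admissible pair. *)
Lemma lam_star_optimal (sigma2 : R) (rho : \bar R) : 0 < sigma2 ->
    (lo < hi)%E -> is_rho_star beta gamma eps rho ->
  let lam := lam_star beta gamma eps rho in
  let mu := mu_star beta gamma eps lam in
  [/\ dual_optimal sigma2 beta gamma eps mu lam, mu k2 = 2 - mu k1
    & forall mu' lam' : 'I_2 -> R,
        dual_optimal sigma2 beta gamma eps mu' lam' -> mu' = mu /\ lam' = lam].
Proof.
move=> sigma_gt0 lohi rstar lam mu.
have [r0 n1 n2 n12 st] := rho_star_stationary rho lohi rstar.
have [lam1E lam2E] := lam_starE rho r0.
set T := 2 / _ in lam1E lam2E; rewrite -/lam in lam1E lam2E.
have T0 : 0 < T by rewrite divr_gt0.
have Tn0 := lt0r_neq0 T0.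
have N1E : N1 (lam k1) (lam k2) = T * N1 (dirx rho) (diry rho).
  by rewrite lam1E lam2E need1_scale.
have N2E : N2 (lam k1) (lam k2) = T * N2 (dirx rho) (diry rho).
  by rewrite lam1E lam2E need2_scale.
have N12 : N1 (lam k1) (lam k2) + N2 (lam k1) (lam k2) = 2.
  by rewrite N1E N2E -mulrDr /T divfK// lt0r_neq0.
have m1 : mu k1 = N1 (lam k1) (lam k2) by rewrite /mu mu_star1E.
have m2 : mu k2 = N2 (lam k1) (lam k2) by rewrite /mu mu_star2E.
have l1 : 0 <= lam k1 by rewrite lam1E mulr_ge0 ?dirx_ge0// ltW.
have l2 : 0 <= lam k2 by rewrite lam2E mulr_ge0 ?diry_ge0// ltW.
have l12 : 0 < lam k1 + lam k2.
  by rewrite lam1E lam2E -mulrDr mulr_gt0// dir_gt0.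
have stl : stat (lam k1) (lam k2).
  rewrite /stationary N1E N2E lam1E lam2E slope_gap_scale//.
  by case: st => [->|[-> ?]|[-> ?]]; rewrite ?mulr0; [apply: Or31|apply: Or32|apply: Or33].
have feas : dual_constraints beta gamma eps mu lam.
  apply/dual_constraintsE; split.
  - by apply/forall_ord2; rewrite m1 m2 N1E N2E; split; apply: mulr_ge0 => //; exact: ltW.
  - exact/forall_ord2.
  - by rewrite m1 m2 N12.
  - by rewrite m1.
  - by rewrite m2.
have opt mu' lam' : dual_constraints beta gamma eps mu' lam' ->
    beta k1 * lam' k1 + beta k2 * lam' k2 <= beta k1 * lam k1 + beta k2 * lam k2 /\
    (beta k1 * lam' k1 + beta k2 * lam' k2 = beta k1 * lam k1 + beta k2 * lam k2 ->
     lam' k1 = lam k1 /\ lam' k2 = lam k2).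
  move=> /dual_constraintsE[mu0 lam0 s le1 le2].
  by apply: (@stationary_optimal R al1 ka1 A1 B1 al2 ka2 A2 B2 _ _ _ _ _ _ _ _
    _ _ _ _ _ _ (mu' k1) (mu' k2)); rewrite ?N12.
split.
- split=> // mu' lam' /opt[le _].
  by rewrite /dual_objective !sum_ord2 ler_pM2l.
- by rewrite m1 m2 -N12; ring.
move=> mu' lam' [con best]; have [le eq] := opt _ _ con.
have := best _ _ feas; rewrite /dual_objective !sum_ord2 ler_pM2l// => ge.
have [e1 e2] : lam' k1 = lam k1 /\ lam' k2 = lam k2.
  by apply: eq; apply/eqP; rewrite eq_le le ge.
(* With lambda determined, mu' dominates mu in both coordinates while its sum is at most 2, the sum
   of mu; hence mu' = mu. *)
move: con => /dual_constraintsE[_ _ s]; rewrite e1 e2 -m1 -m2 => le1 le2.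
have ms : mu k1 + mu k2 = 2 by rewrite m1 m2.
by split; apply/funext => k; case: (ord2_cases k) => ->//; lra.
Qed.

End Dual.

Theorem theorem2 (R : realType) (sigma2 : R) (beta gamma : 'I_2 -> R)
    (eps : 'I_2 -> 'I_2 -> R)
    (hsigma : 0 < sigma2)
    (hbeta : forall k, 0 < beta k)
    (hgamma : forall k, 0 < gamma k)
    (heps : forall j k, 0 < eps j k)
    (hc : forall k, 0 < c beta gamma k)
    (hfeas : dual_feasible sigma2 beta gamma eps) :
  (exists! rho : \bar R, is_rho_star beta gamma eps rho) /\
  forall rho : \bar R, is_rho_star beta gamma eps rho ->
    let lam := lam_star beta gamma eps rho in
    let mu := mu_star beta gamma eps lam in
    [/\ dual_optimal sigma2 beta gamma eps mu lam,
        mu k2 = 2 - mu k1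
      & forall mu' lam' : 'I_2 -> R,
          dual_optimal sigma2 beta gamma eps mu' lam' ->
          mu' = mu /\ lam' = lam].
Proof.
have lohi := rho_lo_lt_hi hbeta hgamma heps hc _ hsigma hfeas.
split=> [|rho]; first exact: rho_star_uniqueness.
exact: lam_star_optimal.
Qed.
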